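(* Let $p,q$ be primes with $p\equiv 1\pmod 4$, $q\equiv 3\pmod 4$ and $q-p=2$, having a common primitive root $g$ (so $\gcd(p-1,q-1)=2$). Let $s$ be the balanced Whiteman generalized cyclotomic sequence of period $N=pq$ defined in the context. Then the 2-adic complexity of $s$ is maximal: $\varphi_2(s)=N$.
   Context: Let $N=pq$ and $e=(p-1)(q-1)/2$. Let $x$ be the unique element of $\mathbb{Z}_N$ with $x\equiv g\pmod p$ and $x\equiv 1\pmod q$. The Whiteman generalized cyclotomic classes of order 2 are $D_i=\{g^{s}x^{i}\bmod N: s=0,1,\dots,e-1\}$ for $i=0,1$; they partition $\mathbb{Z}_N^{*}$. For a prime $r\in\{p,q\}$, let $D_0^{(r)}=\{g^{2t}\bmod r: 0\le t\le \frac{r-1}{2}-1\}$ and $D_1^{(r)}=\{g^{2t+1}\bmod r: 0\le t\le \frac{r-1}{2}-1\}$. For $j=0,1$ let $D_j^{(p)}q=\{yq\bmod N: y\in D_j^{(p)}\}$ and $D_j^{(q)}p=\{yp\bmod N: y\in D_j^{(q)}\}$. Define $C_0=\{0\}\cup D_0\cup D_0^{(p)}q\cup D_0^{(q)}p$ and $C_1=D_1\cup D_1^{(p)}q\cup D_1^{(q)}p$, so $\mathbb{Z}_N=C_0\cup C_1$ (disjoint). The sequence $s=\{s_i\}$ of period $N$ is defined by $s_i=0$ if $i\bmod N\in C_0$ and $s_i=1$ if $i\bmod N\in C_1$. For a binary sequence $s$ of period $N$, let $S(2)=\sum_{i=0}^{N-1}s_i2^{i}$; its 2-adic complexity is $\varphi_2(s)=\left\lfloor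 \log_2\!\left(\frac{2^{N}-1}{\gcd(2^{N}-1,S(2))}+1\right)\right\rfloor$. *)

(* Defs.v *)
From mathcomp Require Import all_boot.
Set Implicit Arguments. Unset Strict Implicit. Unset Printing Implicit Defensive.

Definition primitive_root_mod (r g : nat) : Prop :=
  coprime g r /\ g ^ r.-1 %% r = 1 %% r /\
  (forall k, 0 < k -> k < r.-1 -> g ^ k %% r != 1 %% r).

Definition whiteman_x (p q g : nat) : nat := chinese p q g 1 %% (p * q).

Definition whiteman_e (p q : nat) : nat := ((p - 1) * (q - 1)) %/ 2.

Definition inD1 (p q g y : nat) : bool :=
  [exists s : 'I_(whiteman_e p q),
     (g ^ s * whiteman_x p q g) %% (p * q) == y].

Definition inD1r_mul (N r m g y : nat) : bool :=
  [exists t : 'I_((r - 1) %/ 2),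
     ((g ^ (2 * t + 1) %% r) * m) %% N == y].

Definition inC1 (p q g y : nat) : bool :=
  [|| inD1 p q g y, inD1r_mul (p * q) p q g y | inD1r_mul (p * q) q p g y].

Definition whiteman_seq (p q g i : nat) : nat :=
  if inC1 p q g (i %% (p * q)) then 1 else 0.

Definition S2 (N : nat) (s : nat -> nat) : nat :=
  \sum_(i < N) s i * 2 ^ i.

Definition two_adic_complexity (N : nat) (s : nat -> nat) : nat :=
  trunc_log 2 ((2 ^ N - 1) %/ gcdn (2 ^ N - 1) (S2 N s) + 1).

(* Main.v *)
(** Put [b_i = 1 - 2 s_i], and let [(./p)] and [(./q)] be the Legendre symbols,
    modified to take the value [1] at [0].  Under the parametrisation
    [i = q u + p v] of [Z_N], quadratic reciprocity (with [p = 1 mod 4]) gives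
    [b_i = (u/p) (v/q)].  Hence, modulo a prime [r] dividing [2^N - 1],
    [- 2 S(2) = \sum_i b_i 2^i = (1 + G_p) (1 + G_q)], where [G_p] and [G_q] are
    the quadratic Gauss sums built on the roots of unity [2^q] and [2^p].
    If [2^q = 1 mod r], then [G_p = 0]; otherwise [p | r - 1] and
    [G_p^2 = p], so [G_p = -1] would force [r | p - 1], against [r > p].
    Likewise [G_q = -1] would force [r | q + 1], against [r >= 2 q + 1].
    So [S(2)] is prime to [2^N - 1]. *)
Require Import Defs.
From mathcomp Require Import all_boot all_order all_algebra all_fingroup.
From mathcomp Require Import pgroup finfield zify.
Set Implicit Arguments. Unset Strict Implicit. Unset Printing Implicit Defensive.
Import GRing.Theory Num.Theory.

Local Open Scope ring_scope.

(** * The quadratic character of a prime field *)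

(** The Legendre symbol through Euler's criterion; its values are integers so that they can be cast
    into any field. *)
Definition qchar (p : nat) (a : 'F_p) : int :=
  if a == 0 then 0 else if a ^+ p.-1./2 == 1 then 1 else -1.

Lemma prime_odd_half (p : nat) : prime p -> odd p -> p.-1 = (p.-1./2).*2.
Proof. by move=> /prime_gt0; case: p => //= p _ /negPf op; rewrite even_halfK ?op. Qed.

Lemma qchar0 (p : nat) : qchar (0 : 'F_p) = 0.
Proof. by rewrite /qchar eqxx. Qed.

Lemma Fp_expr_pred (p : nat) (a : 'F_p) : prime p -> a != 0 -> a ^+ p.-1 = 1.
Proof.
move=> pp a0; apply: (mulfI a0); rewrite mulr1 -exprS prednK ?prime_gt0 //.
by rewrite -{2}(expf_card a) card_Fp.
Qed.

Lemma Fp_1N1 (p : nat) : prime p -> odd p -> (1 : 'F_p) != -1.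
Proof.
move=> pp op; rewrite -addr_eq0 -mulr2n -(dvdn_pcharf (pchar_Fp pp)).
by rewrite dvdn_prime2 //; apply: contraL op => /eqP ->.
Qed.

Lemma qchar_euler (p : nat) (a : 'F_p) : prime p -> odd p ->
  (qchar a)%:~R = a ^+ p.-1./2.
Proof.
move=> pp op; rewrite /qchar; have p1 := prime_gt1 pp.
have [->|a0] := eqVneq a 0.
  by rewrite expr0n; have -> : (p.-1./2 == 0)%N = false by lia.
case: eqVneq => [->//|n1]; apply/eqP; rewrite rmorphN1 eq_sym.
have: (a ^+ p.-1./2) ^+ 2 == 1.
  by rewrite -exprM muln2 -prime_odd_half // Fp_expr_pred.
by rewrite sqrf_eq1 (negPf n1).
Qed.

Lemma qchar_cases (p : nat) (a : 'F_p) : a != 0 -> qchar a = 1 \/ qchar a = -1.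
Proof. by move=> /negPf a0; rewrite /qchar a0; case: eqP; [left|right]. Qed.

Lemma qchar_eq0 (p : nat) (a : 'F_p) : (qchar a == 0) = (a == 0).
Proof.
have [->|/qchar_cases] := eqVneq a 0; first by rewrite qchar0.
by case=> ->.
Qed.

(** For odd [p] the integers 0, 1, -1 stay distinct in ['F_p], so identities between symbols can be
    checked there. *)
Lemma qchar_inj (p : nat) (a : 'F_p) (z : int) : prime p -> odd p ->
  z \in [:: 0; 1; -1] -> (z%:~R : 'F_p) = a ^+ p.-1./2 -> qchar a = z.
Proof.
move=> pp op zin; rewrite -qchar_euler // => /esym /eqP.
have n1 := Fp_1N1 pp op.
have n2 : (-1 : 'F_p) != 1 by rewrite eq_sym.
have n3 : (0 : 'F_p) != -1 by rewrite eq_sym oppr_eq0 oner_eq0.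
have n4 : (0 : 'F_p) != 1 by rewrite eq_sym oner_eq0.
by move: zin; rewrite !inE => /or3P [] /eqP ->;
  have [->|/qchar_cases [] ->] := eqVneq a 0;
  rewrite ?qchar0 ?rmorphN1 ?rmorph0 ?rmorph1 ?oppr_eq0 ?oner_eq0
    ?(negPf n1) ?(negPf n2) ?(negPf n3) ?(negPf n4).
Qed.

Lemma qcharM (p : nat) (a b : 'F_p) : prime p -> odd p ->
  qchar (a * b) = qchar a * qchar b.
Proof.
move=> pp op; apply: qchar_inj => //; last by rewrite rmorphM /= !qchar_euler // exprMn.
have [->|/qchar_cases [] ->] := eqVneq a 0; rewrite ?qchar0 ?mul0r //;
by have [->|/qchar_cases [] ->] := eqVneq b 0; rewrite ?qchar0 ?mulr0.
Qed.

Lemma qchar1 (p : nat) : qchar (1 : 'F_p) = 1.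
Proof. by rewrite /qchar oner_eq0 expr1n eqxx. Qed.

Lemma qcharX (p : nat) (a : 'F_p) (n : nat) : prime p -> odd p ->
  qchar (a ^+ n) = qchar a ^+ n.
Proof.
move=> pp op; elim: n => [|n IH]; first by rewrite !expr0 qchar1.
by rewrite !exprS qcharM // IH.
Qed.

Lemma qcharN1 (p : nat) : prime p -> odd p ->
  qchar (-1 : 'F_p) = (-1) ^+ p.-1./2.
Proof.
move=> pp op; apply: qchar_inj => //; last by rewrite rmorphXn /= rmorphN1.
by rewrite -signr_odd; case: odd.
Qed.

(** Otherwise all [p - 1] nonzero elements would be roots of ['X^(p.-1./2) - 1]. *)
Lemma qchar_nonresidue (p : nat) : prime p -> odd p ->
  exists a : 'F_p, qchar a = -1.
Proof.
move=> pp op; have p1 := prime_gt1 pp; have m0 : (0 < p.-1./2)%N by lia.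
have [/existsP [a /eqP]|H] := boolP [exists a : 'F_p, qchar a == -1]; first by exists a.
have := @max_poly_roots _ ('X^(p.-1./2) - 1 : {poly 'F_p}) (enum (predC1 (0 : 'F_p))).
rewrite -size_poly_eq0 size_XnsubC // => /(_ isT) => H1.
suff: (size (enum (predC1 (0%R : 'F_p))) < (p.-1./2).+1)%N.
  by rewrite -cardE cardC1 card_Fp //; lia.
apply: H1; last exact: enum_uniq.
apply/allP => a; rewrite mem_enum inE => a0; rewrite /root !hornerE subr_eq0.
have := existsPn H a; rewrite -qchar_euler //.
by case: (qchar_cases a0) => ->.
Qed.

(** Multiplication by a nonresidue permutes ['F_p] and changes the sign of the sum. *)
Lemma qchar_sum (p : nat) : prime p -> odd p -> \sum_(a : 'F_p) qchar a = 0.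
Proof.
move=> pp op; have [b qb] := qchar_nonresidue pp op.
have b0 : b != 0 by rewrite -qchar_eq0 qb.
have : \sum_(a : 'F_p) qchar a = - \sum_(a : 'F_p) qchar a.
  rewrite {1}(reindex_inj (mulfI b0)) -sumrN; apply: eq_bigr => a _.
  by rewrite qcharM // qb mulN1r.
by lia.
Qed.

(** * Additive characters and quadratic Gauss sums *)

Definition addchar (F : fieldType) (p : nat) (w : F) (a : 'F_p) : F := w ^+ a.

Definition gauss_sum (F : fieldType) (p : nat) (w : F) : F :=
  \sum_(a : 'F_p) (qchar a)%:~R * addchar w a.

Lemma addchar_nat (F : fieldType) (p : nat) (w : F) (n : nat) : prime p ->
  w ^+ p = 1 -> addchar w (n%:R : 'F_p) = w ^+ n.
Proof. by move=> pp wp; rewrite /addchar val_Fp_nat // expr_mod. Qed.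

Lemma addcharD (F : fieldType) (p : nat) (w : F) (a b : 'F_p) : prime p ->
  w ^+ p = 1 -> addchar w (a + b) = addchar w a * addchar w b.
Proof.
move=> pp wp; rewrite -{1}(natr_Zp a) -{1}(natr_Zp b) -natrD addchar_nat //.
by rewrite exprD.
Qed.

Lemma addcharMn (F : fieldType) (p : nat) (w : F) (n : nat) (a : 'F_p) : prime p ->
  w ^+ p = 1 -> addchar w (n%:R * a) = addchar w a ^+ n.
Proof.
move=> pp wp; rewrite -{1}(natr_Zp a) -natrM addchar_nat //.
by rewrite mulnC exprM.
Qed.

Lemma addchar_eq1 (F : fieldType) (p : nat) (w : F) (a : 'F_p) : prime p ->
  w ^+ p = 1 -> w != 1 -> (addchar w a == 1) = (a == 0).
Proof.
move=> pp wp w1; apply/eqP/eqP => [aw|->]; last exact: expr0.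
apply/eqP; apply: contraNT w1 => a0.
have <- : addchar w (a^-1 * a) = w by rewrite mulVf // -[1]/(1%:R) addchar_nat.
by rewrite -(natr_Zp a^-1) addcharMn // aw expr1n.
Qed.

(** For [c != 0], shifting [a] by 1 multiplies the sum by [addchar w c], which is not 1. *)
Lemma addchar_sum (F : fieldType) (p : nat) (w : F) (c : 'F_p) : prime p ->
  w ^+ p = 1 -> w != 1 ->
  \sum_(a : 'F_p) addchar w (a * c) = if c == 0 then p%:R else 0.
Proof.
move=> pp wp w1; have [->|c0] := eqVneq c 0.
  rewrite (eq_bigr (fun=> 1)) => [|a _]; last by rewrite mulr0 /addchar expr0.
  by rewrite sumr_const card_Fp.
apply/eqP; set S := \sum_a _; have : S * addchar w c == S.
  rewrite [X in _ == X](reindex_inj (addIr 1)) mulr_suml; apply/eqP.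
  by apply: eq_bigr => a _; rewrite mulrDl mul1r addcharD.
rewrite -subr_eq0 -[X in _ - X]mulr1 -mulrBr mulf_eq0 subr_eq0 addchar_eq1 //.
by rewrite (negPf c0) orbF.
Qed.

(* Substituting [b = a * c] in the double sum over [a, b] isolates the sum over
   [a] of an additive character, which vanishes unless [c = -1]. *)
Lemma gauss_sum_sqr (F : fieldType) (p : nat) (w : F) : prime p -> odd p ->
  w ^+ p = 1 -> w != 1 ->
  gauss_sum p w ^+ 2 = (-1) ^+ p.-1./2 * p%:R.
Proof.
move=> pp op wp w1; rewrite expr2 {1}/gauss_sum mulr_suml.
transitivity (\sum_(a : 'F_p | a != 0) \sum_(c : 'F_p)
    (qchar c)%:~R * addchar w (a * (1 + c))).
  rewrite (bigID (fun a : 'F_p => a == 0)) /= big1 ?add0r; last first.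
    by move=> a /eqP ->; rewrite qchar0 !mul0r.
  apply: eq_bigr => a a0; rewrite /gauss_sum mulr_sumr.
  rewrite (reindex_inj (mulfI a0)); apply: eq_bigr => c _.
  rewrite mulrDr mulr1 addcharD // mulrACA -rmorphM /= qcharM // [qchar a * _]mulrA.
  have -> : qchar a * qchar a = 1 by case: (qchar_cases a0) => ->.
  by rewrite mul1r.
rewrite exchange_big /=.
transitivity (\sum_(c : 'F_p) ((qchar c)%:~R * (if c == -1 then p%:R else 0)
     - (qchar c)%:~R : F)).
  apply: eq_bigr => c _; rewrite -mulr_sumr -[X in _ - X]mulr1 -mulrBr.
  congr (_ * _); rewrite -addr_eq0 [c + 1]addrC -(addchar_sum _ pp wp w1).
  by rewrite [in RHS](bigD1 0) //= mul0r {2}/addchar expr0 addrAC subrr add0r.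
rewrite sumrB -[X in _ - X](rmorph_sum (intr : int -> F)) qchar_sum // rmorph0 subr0.
rewrite (bigD1 (-1)) //= eqxx big1 ?addr0 => [|c /negPf ->]; last by rewrite mulr0.
by rewrite qcharN1 // rmorphXn /= rmorphN1.
Qed.

(** * Quadratic reciprocity *)

(** By Fermat, [p] divides [q ^ p.-1 - 1], the number of units of the field with [q ^ p.-1]
    elements; Cauchy's theorem gives a unit of order [p]. *)
Lemma primitive_pth_root_exists (p q : nat) : prime p -> prime q -> p != q ->
  exists F : finFieldType, q \in [pchar F] /\ exists w : F, w ^+ p = 1 /\ w != 1.
Proof.
move=> pp pq npq; have p1 := prime_gt1 pp.
have [F chF cF] := @pPrimePowerField q p.-1 pq ltac:(lia).
exists F; split => //.
have dv : (p %| #|[set: {unit F}]|)%N.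
  rewrite card_finField_unit cF -subn1.
  rewrite -eqn_mod_dvd ?expn_gt0 ?prime_gt0 //.
  have : q%:R != 0 :> 'F_p.
    by rewrite -(dvdn_pcharf (pchar_Fp pp)) dvdn_prime2.
  by move=> q0; apply/eqP; rewrite -!(val_Fp_nat pp) natrX Fp_expr_pred.
have [x _ ox] := Cauchy pp dv.
exists (val x); rewrite -FinRing.val_unitX -{1}ox expg_order; split => //.
apply: contraTneq p1 => x1; rewrite -ox; have -> : x = 1%g by apply: val_inj.
by rewrite order1.
Qed.

(* The Frobenius of a field of characteristic [q] multiplies the Gauss sum by
   [(q / p)]; it also multiplies it by [p ^ ((q - 1) / 2)], the square of the
   Gauss sum being [p]. *)
Lemma qchar_reciprocity (p q : nat) : prime p -> prime q -> p != q ->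
  (p %% 4 = 1)%N -> odd q -> qchar (q%:R : 'F_p) = qchar (p%:R : 'F_q).
Proof.
move=> pp pq npq p4 oq; have op : odd p by lia.
have [F [chF [w [wp w1]]]] := primitive_pth_root_exists pp pq npq.
have q0 : (q%:R : 'F_p) != 0.
  by rewrite -(dvdn_pcharf (pchar_Fp pp)) dvdn_prime2.
have p0 : (p%:R : 'F_q) != 0.
  by rewrite -(dvdn_pcharf (pchar_Fp pq)) dvdn_prime2 // eq_sym.
set G := gauss_sum p w.
have G2 : G ^+ 2 = p%:R.
  rewrite gauss_sum_sqr // -signr_odd; have -> : odd p.-1./2 = false by lia.
  by rewrite mul1r.
have G0 : G != 0.
  rewrite -sqrf_eq0 G2 -(dvdn_pcharf chF) dvdn_prime2 //; by rewrite eq_sym.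
have Gq1 : G ^+ q = G * (qchar (p%:R : 'F_q))%:~R.
  have eq : q = (1 + 2 * q.-1./2)%N by have := prime_gt1 pq; lia.
  rewrite {1}eq exprD expr1 exprM G2; congr (_ * _); apply/eqP.
  (* Comparing two integers modulo [q] carries Euler's criterion from ['F_q] over to [F]. *)
  rewrite -subr_eq0 -natrX -[X in X - _]mulrz_nat -intrB -(dvdz_pcharf chF).
  rewrite (dvdz_pcharf (pchar_Fp pq)) intrB qchar_euler // mulrz_nat natrX.
  by rewrite subrr.
have Gq2 : G ^+ q = (qchar (q%:R : 'F_p))%:~R * G.
  rewrite -(pFrobenius_autE chF) rmorph_sum mulr_sumr.
  (* Replacing [a] by [q * a] on the right produces a second symbol of [q], and the two cancel. *)
  rewrite [RHS](reindex_inj (mulfI q0)); apply: eq_bigr => a _ /=.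
  rewrite rmorphM /= rmorph_int pFrobenius_autE -addcharMn // qcharM //.
  rewrite mulrA -intrM mulrA.
  have -> : qchar (q%:R : 'F_p) * qchar (q%:R : 'F_p) = 1.
    by case: (qchar_cases q0) => ->.
  by rewrite mul1r.
have := Gq1; rewrite Gq2 mulrC => /(mulfI G0) /eqP.
rewrite -subr_eq0 -intrB -(dvdz_pcharf chF).
have q1 := prime_gt1 pq.
(* Two distinct signs differ by 2 up to sign, which the odd prime [q] does not divide. *)
have h : ~~ (q %| 2)%N by rewrite dvdn_prime2 //; apply: contraL oq => /eqP ->.
by case: (qchar_cases q0) => ->; case: (qchar_cases p0) => -> //;
  rewrite dvdzE (negPf h).
Qed.

(** * Gauss sums modulo an odd prime are never -1 *)

(** A Gauss sum -1 would make its square, [p] or [-p], equal to 1 in ['F_r]. Both signs are treated,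
    to serve primes that are 1 and 3 modulo 4 alike. *)
Lemma one_add_gauss_sum_neq0 (p r : nat) (w : 'F_r) : prime p -> odd p ->
  prime r -> odd r -> w ^+ p = 1 -> 1 + gauss_sum p w != 0.
Proof.
move=> pp op pr or wp; have p1 := prime_gt1 pp; have r1 := prime_gt1 pr.
have [->|w1] := eqVneq w 1.
  suff -> : gauss_sum p (1 : 'F_r) = 0 by rewrite addr0 oner_eq0.
  rewrite /gauss_sum (eq_bigr (fun a => (qchar a)%:~R)) => [|a _].
    by rewrite -[LHS](rmorph_sum (intr : int -> 'F_r)) qchar_sum // rmorph0.
  by rewrite /addchar expr1n mulr1.
have w0 : w != 0.
  apply/eqP => w0; move/eqP: wp; rewrite w0 expr0n.
  by have -> : (p == 0)%N = false by lia.
(* [p | r - 1] forces [r >= 2 p + 1], leaving no room for [r | p - 1] or [r | p + 1]. *)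
have dv : (p %| r.-1)%N.
  have [m pm mp] := prim_order_exists (prime_gt0 pp) wp.
  rewrite (_ : p = m); first by rewrite (prim_order_dvd pm) Fp_expr_pred.
  case/primeP: pp => _ /(_ m mp) /orP [/eqP m1|/eqP //].
  by move: (prim_expr_order pm) w1; rewrite m1 expr1 => ->; rewrite eqxx.
apply/negP; rewrite addrC addr_eq0 => /eqP GN.
have : gauss_sum p w ^+ 2 == 1 by rewrite GN sqrrN expr1n.
rewrite gauss_sum_sqr // -signr_odd.
case/dvdnP: dv => k rk.
(* [k = 0] would give [r = 1], and [k = 1] the even number [r = p + 1]. *)
have rk2 : (p.*2 < r)%N.
  by case: k rk => [|[|k]] rk; nia.
case: odd; rewrite ?mul1r ?mulN1r.
  rewrite eq_sym -addr_eq0 -[1]/(1%:R) -natrD -(dvdn_pcharf (pchar_Fp pr)).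
  by move/dvdn_leq => /(_ isT); lia.
have -> : p = (1 + p.-1)%N by lia.
rewrite natrD addrC -subr_eq0 addrK -(dvdn_pcharf (pchar_Fp pr)).
by move/dvdn_leq; lia.
Qed.

(** * Congruences and primitive roots *)

Lemma Fp_nat_eq (p m n : nat) : prime p ->
  ((m%:R : 'F_p) == n%:R) = (m == n %[mod p])%N.
Proof. by move=> pp; rewrite -val_eqE /= -[RHS]/(m %% p == n %% p)%N -!val_Fp_nat. Qed.

Lemma Fp_nat_mod_dvd (p d n : nat) : prime p -> (p %| d)%N ->
  ((n %% d)%:R : 'F_p) = n%:R.
Proof. by move=> pp pd; rewrite -Fp_nat_mod // modn_dvdm // Fp_nat_mod. Qed.

Lemma Fp_crt_eq (p q m n : nat) : prime p -> prime q -> p != q ->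
  (m == n %[mod p * q])%N =
  ((m%:R : 'F_p) == n%:R) && ((m%:R : 'F_q) == n%:R).
Proof.
move=> pp pq npq; rewrite chinese_remainder ?Fp_nat_eq //.
by rewrite prime_coprime // dvdn_prime2.
Qed.

Lemma primitive_root_modP (p g : nat) : prime p -> primitive_root_mod p g ->
  (p.-1).-primitive_root (g%:R : 'F_p).
Proof.
move=> pp [_ [g1 gk]]; have p1 := prime_gt1 pp.
apply/andP; split; first by lia.
apply/forallP => i; rewrite unity_rootE -natrX -[1]/(1%:R) Fp_nat_eq //.
have := ltn_ord i; case: (eqVneq i.+1 p.-1) => [->|ni] li; first by rewrite g1 eqxx.
by rewrite (negPf (gk _ _ _)) //; lia.
Qed.

Lemma qchar_primitive_root (p : nat) (g : 'F_p) : prime p -> odd p ->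
  (p.-1).-primitive_root g -> qchar g = -1.
Proof.
move=> pp op pg; have p1 := prime_gt1 pp; rewrite /qchar.
have -> : (g == 0) = false.
  apply/eqP => g0; have /eqP := prim_expr_order pg; rewrite g0 expr0n.
  by have -> : (p.-1 == 0)%N = false by lia.
rewrite -(prim_order_dvd pg); case: ifP => // /dvdn_leq.
by lia.
Qed.

Lemma Fp_index (p : nat) (g a : 'F_p) : prime p ->
  (p.-1).-primitive_root g -> a != 0 -> exists2 k : nat, (k < p.-1)%N & a = g ^+ k.
Proof.
by move=> pp pg /(Fp_expr_pred pp) /(prim_rootP pg) [k ->]; exists k.
Qed.

(** Removing the common parity and halving leaves a system with coprime moduli. The bound is the
    least common multiple of [2 * m] and [2 * n]; it becomes [whiteman_e p q] in [inD1E]. *)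
Lemma chinese_double (m n a b : nat) : coprime m n -> (0 < m)%N -> (0 < n)%N ->
  odd a = odd b -> exists s, [/\ (s < 2 * m * n)%N,
    (s = a %[mod 2 * m])%N & (s = b %[mod 2 * n])%N].
Proof.
move=> cmn m0 n0 oab; have e2 x y d : (x = y %[mod d] -> odd b + 2 * x = odd b + 2 * y %[mod 2 * d])%N.
  by move=> xy; apply/eqP; rewrite eqn_modDl -!muln_modr xy.
exists ((odd b + 2 * chinese m n a./2 b./2) %% (2 * m * n))%N; split.
- by rewrite ltn_mod !muln_gt0 m0.
- rewrite modn_dvdm; last exact: dvdn_mulr.
  by rewrite (e2 _ _ _ (chinese_modl cmn _ _)) -oab mul2n odd_double_half.
- rewrite modn_dvdm; last by rewrite mulnAC; exact: dvdn_mulr.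
  by rewrite (e2 _ _ _ (chinese_modr cmn _ _)) mul2n odd_double_half.
Qed.

(** * Cyclotomic classes in terms of quadratic characters *)

(** The index is [q * u] modulo [p] and [p * v] modulo [q], so it is [q] times an odd power of [g]
    exactly when [v = 0] and [u] is that power. Odd powers of a primitive root are the
    nonresidues. *)
Lemma inD1r_mulE (p q g : nat) (u : 'F_p) (v : 'F_q) :
  prime p -> prime q -> p != q -> odd p -> primitive_root_mod p g ->
  inD1r_mul (p * q) p q g ((q * u + p * v) %% (p * q)) =
  (v == 0) && (qchar u == -1).
Proof.
move=> pp pq npq op hg; have pg := primitive_root_modP pp hg.
have gN := qchar_primitive_root pp op pg.
have q0 : (q%:R : 'F_p) != 0.
  by rewrite -(dvdn_pcharf (pchar_Fp pp)) dvdn_prime2.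
have p0 : (p%:R : 'F_q) != 0.
  by rewrite -(dvdn_pcharf (pchar_Fp pq)) dvdn_prime2 // eq_sym.
have E t : (((g ^ (2 * t + 1) %% p) * q) %% (p * q) == (q * u + p * v) %% (p * q))%N
    = (u == g%:R ^+ (2 * t + 1)) && (v == 0).
  rewrite Fp_crt_eq // !natrD !natrM Fp_nat_mod // !natr_Zp pchar_Fp_0 // mul0r addr0.
  rewrite (pchar_Fp_0 pq) mulr0 mul0r add0r natrX mulrC (inj_eq (mulfI q0)) eq_sym.
  by rewrite [_ == p%:R * v]eq_sym mulf_eq0 (negPf p0).
apply/existsP/andP => [[t]|[v0 /eqP qu]].
  rewrite E => /andP [/eqP -> ->]; split=> //.
  by rewrite qcharX // gN addn1 mul2n -signr_odd /= odd_double.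
have u0 : u != 0 by rewrite -qchar_eq0 qu.
have [k lk uk] := Fp_index pp pg u0.
have ok : odd k.
  by move: qu; rewrite uk qcharX // gN -signr_odd; case: odd.
have lt : (k./2 < (p - 1) %/ 2)%N by have := prime_gt1 pp; lia.
exists (Ordinal lt); rewrite E v0 andbT uk /=.
by have -> : (2 * k./2 + 1 = k)%N by lia.
Qed.

(** [g ^ s * x] is [g ^ s.+1] modulo [p] and [g ^ s] modulo [q], so its symbols are opposite.
    Conversely, opposite symbols give discrete logarithms of opposite parity, from which
    [chinese_double] recovers [s]. *)
Lemma inD1E (p q g : nat) (y : nat) :
  prime p -> prime q -> odd p -> q = (p + 2)%N -> (y < p * q)%N ->
  primitive_root_mod p g -> primitive_root_mod q g ->
  inD1 p q g y = (qchar (y%:R : 'F_p) * qchar (y%:R : 'F_q) == -1).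
Proof.
move=> pp pq op eq ly hp hq; have oq : odd q by lia.
have npq : p != q by lia.
have p1 := prime_gt1 pp.
have ep : (2 * p.-1./2 = p.-1)%N by rewrite mul2n -prime_odd_half.
have eqq : (2 * q.-1./2 = q.-1)%N by rewrite mul2n -prime_odd_half.
have m0 : (0 < p.-1./2)%N by lia.
have n0 : (0 < q.-1./2)%N by lia.
(* As [q = p + 2], the two halves are consecutive integers. *)
have cm : coprime p.-1./2 q.-1./2.
  by have -> : q.-1./2 = p.-1./2.+1; [lia | exact: coprimenS].
have cpq : coprime p q by rewrite prime_coprime // dvdn_prime2.
have pg := primitive_root_modP pp hp; have qg := primitive_root_modP pq hq.
have gN := qchar_primitive_root pp op pg; have gNq := qchar_primitive_root pq oq qg.
have E s : ((g ^ s * whiteman_x p q g) %% (p * q) == y)%N =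
    ((y%:R : 'F_p) == g%:R ^+ s.+1) && ((y%:R : 'F_q) == g%:R ^+ s).
  rewrite -[in LHS](modn_small ly) Fp_crt_eq // !natrM !natrX.
  rewrite /whiteman_x !Fp_nat_mod_dvd ?(dvdn_mulr _ (dvdnn _)) ?(dvdn_mull _ (dvdnn _)) //.
  rewrite -(Fp_nat_mod pp (chinese _ _ _ _)) chinese_modl // Fp_nat_mod //.
  rewrite -(Fp_nat_mod pq (chinese _ _ _ _)) chinese_modr // Fp_nat_mod //.
  by rewrite mulr1 -exprSr ![_ == y%:R]eq_sym.
apply/idP/eqP => [/existsP [s]|].
  rewrite E => /andP [/eqP -> /eqP ->].
  by rewrite !qcharX // gN gNq exprS mulN1r mulNr -exprMn mulN1r opprK expr1n.
move=> qy.
have yp0 : (y%:R : 'F_p) != 0.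
  by apply: contra_eq_neq qy => ->; rewrite qchar0 mul0r.
have yq0 : (y%:R : 'F_q) != 0.
  by apply: contra_eq_neq qy => ->; rewrite qchar0 mulr0.
have [a la ya] := Fp_index pp pg yp0; have [b lb yb] := Fp_index pq qg yq0.
(* Modulo [p.-1], adding [p.-2] subtracts 1: [s.+1] has to match [a] while [s] matches [b]. *)
have oab : odd (a + p.-2)%N = odd b.
  move: qy; rewrite ya yb !qcharX // gN gNq -exprD -signr_odd.
  by case H: odd => // _; clear -H op p1; lia.
have [s [ls sa sb]] := chinese_double cm m0 n0 oab.
have lt : (s < whiteman_e p q)%N.
  rewrite /whiteman_e !subn1 -muln_divA; last by rewrite -eqq dvdn_mulr.
  by rewrite divn2 -{1}ep.
apply/existsP; exists (Ordinal lt); rewrite E /=.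
rewrite ep in sa; rewrite eqq in sb.
apply/andP; split; apply/eqP.
  rewrite exprS -(prim_expr_mod pg s) sa (prim_expr_mod pg) -exprS.
  have -> : ((a + p.-2).+1 = a + p.-1)%N by clear -p1; lia.
  by rewrite exprD (prim_expr_order pg) mulr1.
by rewrite -(prim_expr_mod qg s) sb (prim_expr_mod qg).
Qed.

(** The value 1 at 0 lets one product formula also cover the indices with a vanishing coordinate. *)
Definition qchar_ext (p : nat) (a : 'F_p) : int := qchar a + (a == 0)%:R.

(** On units, the symbols of the index modulo [p] and [q] contribute the extra factor [(q/p) (p/q)],
    which is 1 by reciprocity. *)
Lemma whiteman_seqE (p q g : nat) (u : 'F_p) (v : 'F_q) :
  prime p -> prime q -> (p %% 4 = 1)%N -> q = (p + 2)%N ->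
  primitive_root_mod p g -> primitive_root_mod q g ->
  1 - 2 * (whiteman_seq p q g ((q * u + p * v) %% (p * q)))%:Z =
  qchar_ext u * qchar_ext v.
Proof.
move=> pp pq p4 eq hp hq; have op : odd p by lia.
have oq : odd q by lia.
have npq : p != q by lia.
have rec := qchar_reciprocity pp pq npq p4 oq.
have q0 : (q%:R : 'F_p) != 0.
  by rewrite -(dvdn_pcharf (pchar_Fp pp)) dvdn_prime2.
have lt : ((q * u + p * v) %% (p * q) < p * q)%N.
  by rewrite ltn_mod muln_gt0 !prime_gt0.
have E2 : inD1r_mul (p * q) q p g ((q * u + p * v) %% (p * q)) =
    (u == 0) && (qchar v == -1).
  by rewrite mulnC addnC inD1r_mulE // eq_sym.
rewrite /whiteman_seq modn_mod /inC1 inD1E // inD1r_mulE // E2.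
rewrite !Fp_nat_mod_dvd ?(dvdn_mulr _ (dvdnn _)) ?(dvdn_mull _ (dvdnn _)) // !natrD !natrM !natr_Zp.
rewrite (pchar_Fp_0 pp) (pchar_Fp_0 pq) !mul0r addr0 add0r !qcharM // -rec mulrACA.
have -> : qchar (q%:R : 'F_p) * qchar (q%:R : 'F_p) = 1.
  by case: (qchar_cases q0) => ->.
rewrite mul1r /qchar_ext.
have [->|u0] := eqVneq u 0; have [->|v0] := eqVneq v 0; rewrite ?qchar0 //=.
- by case: (qchar_cases v0) => ->.
- by case: (qchar_cases u0) => ->.
- by case: (qchar_cases v0) => ->; case: (qchar_cases u0) => ->.
Qed.

(** * The generating function and the gcd *)

Lemma qchar_ext_sum (F : fieldType) (p : nat) (w : F) :
  \sum_(a : 'F_p) (qchar_ext a)%:~R * addchar w a = 1 + gauss_sum p w.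
Proof.
have e1 : \sum_(a : 'F_p) (a == 0)%:R * addchar w a = 1.
  rewrite (bigD1 0) //= big1 ?eqxx => [|a /negPf ->]; last by rewrite mul0r.
  by rewrite /addchar expr0 mulr1 addr0.
rewrite -[X in _ = X + _]e1 -big_split; apply: eq_bigr => a _ /=.
by rewrite -mulrDl /qchar_ext intrD addrC; case: eqP.
Qed.

(** [b ^ (q * u + p * v)] splits as [(b ^ q) ^ u * (b ^ p) ^ v], so the sum over pairs [(u, v)]
    factors. *)
Lemma whiteman_gen_fun (F : fieldType) (p q g : nat) (b : F) :
  prime p -> prime q -> (p %% 4 = 1)%N -> q = (p + 2)%N ->
  primitive_root_mod p g -> primitive_root_mod q g -> b ^+ (p * q) = 1 ->
  \sum_(i < p * q) (1 - 2 * (whiteman_seq p q g i)%:Z)%:~R * b ^+ i =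
  (1 + gauss_sum p (b ^+ q)) * (1 + gauss_sum q (b ^+ p)).
Proof.
move=> pp pq p4 eq hp hq b1; have npq : p != q by lia.
have N0 : (0 < p * q)%N by rewrite muln_gt0 !prime_gt0.
pose h (x : 'F_p * 'F_q) := Ordinal (ltn_pmod (q * x.1 + p * x.2) N0).
have q0 : (q%:R : 'F_p) != 0.
  by rewrite -(dvdn_pcharf (pchar_Fp pp)) dvdn_prime2.
have p0 : (p%:R : 'F_q) != 0.
  by rewrite -(dvdn_pcharf (pchar_Fp pq)) dvdn_prime2 // eq_sym.
have hinj : injective h.
  move=> [u v] [u' v'] /(congr1 val) /= /eqP; rewrite Fp_crt_eq //.
  rewrite !natrD !natrM !natr_Zp (pchar_Fp_0 pp) (pchar_Fp_0 pq).
  rewrite !mul0r !addr0 !add0r (inj_eq (mulfI q0)) (inj_eq (mulfI p0)).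
  by case/andP => /eqP -> /eqP ->.
have hbij : bijective h.
  by apply: inj_card_bij hinj _; rewrite card_ord card_prod !card_Fp.
rewrite (reindex h) /=; last exact: onW_bij.
rewrite -!qchar_ext_sum mulr_suml.
under [RHS]eq_bigr do rewrite mulr_sumr.
rewrite pair_big /=; apply: eq_bigr => [[u v]] _ /=.
rewrite whiteman_seqE // intrM expr_mod // exprD !exprM.
by rewrite /addchar mulrACA.
Qed.

(** At a common prime divisor [r], taking [b = 2] in ['F_r] makes the left side of
    [whiteman_gen_fun] vanish, while neither factor on the right does. *)
Lemma whiteman_gcd (p q g : nat) :
  prime p -> prime q -> (p %% 4 = 1)%N -> q = (p + 2)%N ->
  primitive_root_mod p g -> primitive_root_mod q g ->
  coprime (2 ^ (p * q) - 1) (S2 (p * q) (whiteman_seq p q g)).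
Proof.
move=> pp pq p4 eq hp hq; have op : odd p by lia.
have oq : odd q by lia.
set M := (2 ^ (p * q) - 1)%N; set S := S2 _ _.
have eM : (2 ^ (p * q) = M + 1)%N by rewrite subnK // expn_gt0.
have N0 : (0 < p * q)%N by rewrite muln_gt0 !prime_gt0.
have oM : odd M by have := oddX 2 (p * q); rewrite eM addn1 /= orbF; lia.
rewrite /coprime; apply: contraT => d1.
have d0 : (0 < gcdn M S)%N by rewrite gcdn_gt0 odd_gt0.
have pr : prime (pdiv (gcdn M S)) by apply: pdiv_prime; lia.
have := pdiv_dvd (gcdn M S); move: (pdiv _) pr => r pr; rewrite dvdn_gcd => /andP [rM rS].
have or : odd r by apply: dvdn_odd rM oM.
have b1 : (2 : 'F_r) ^+ (p * q) = 1.
  rewrite -natrX eM natrD; apply/eqP; rewrite -subr_eq0 addrK.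
  by rewrite -(dvdn_pcharf (pchar_Fp pr)).
have wpq : (2 ^+ q : 'F_r) ^+ p = 1 by rewrite -exprM mulnC.
have wqp : (2 ^+ p : 'F_r) ^+ q = 1 by rewrite -exprM.
have := whiteman_gen_fun pp pq p4 eq hp hq b1.
rewrite (eq_bigr (fun i : 'I_(p * q) => (2 : 'F_r) ^+ i
    - 2 * (whiteman_seq p q g i * 2 ^ i)%:R)); last first.
  by move=> i _; rewrite intrB intrM mulrBl mul1r -mulrA natrM natrX.
rewrite sumrB -mulr_sumr -natr_sum -[X in _ - 2 * X]/(S%:R).
have -> : (S%:R : 'F_r) = 0 by apply/eqP; rewrite -(dvdn_pcharf (pchar_Fp pr)).
(* The geometric sum times [2 - 1] is [2 ^ (p * q) - 1], which is 0 in ['F_r]. *)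
have -> : \sum_(i < p * q) (2 : 'F_r) ^+ i = 0.
  have := subrX1 (2 : 'F_r) (p * q); rewrite b1 subrr => /esym.
  by rewrite (_ : 2 - 1 = 1) ?mul1r // mulrSr addrK.
rewrite mulr0 subrr => /esym /eqP; rewrite mulf_eq0.
by rewrite !(negPf (one_add_gauss_sum_neq0 _ _ _ _ _)).
Qed.

Close Scope ring_scope.

Theorem theorem2 (p q g : nat) :
  prime p -> prime q ->
  p %% 4 = 1 -> q %% 4 = 3 -> q = p + 2 ->
  primitive_root_mod p g -> primitive_root_mod q g ->
  two_adic_complexity (p * q) (whiteman_seq p q g) = p * q.
Proof.
move=> pp pq p4 _ eq hp hq; rewrite /two_adic_complexity.
(* With gcd 1 the logarithm is taken of exactly [2 ^ (p * q)]. *)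
rewrite (eqP (whiteman_gcd pp pq p4 eq hp hq)) divn1 subnK ?expn_gt0 //.
exact: trunc_expnK.
Qed.
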